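(* Let $\mu$ and $\nu$ be probability measures on $\mathbb{R}^d$, and let $$\Pi(\mu,\nu) := \{\gamma \text{ probability measure on } \mathbb{R}^d\times\mathbb{R}^d : (\pi_X)_\#\gamma=\mu,\ (\pi_Y)_\#\gamma=\nu\}$$ be the set of all couplings of $\mu$ and $\nu$. Define the cosine similarity $$\phi(x,y) := \cos(x,y) = \frac{\langle x,y\rangle}{\|x\|\,\|y\|}$$ and the cost function $c(x,y) := -\phi(x,y) = -\cos(x,y)$. Then any coupling $\gamma^\star\in\Pi(\mu,\nu)$ that maximizes the expected cosine similarity, i.e. $$\gamma^\star \in \arg\max_{\gamma\in\Pi(\mu,\nu)} \int_{\mathbb{R}^d\times\mathbb{R}^d} \phi(x,y)\, d\gamma(x,y),$$ is also an optimal transport plan for the cost $c$, i.e. $$\gamma^\star \in \arg\min_{\gamma\in\Pi(\mu,\nu)} \int_{\mathbb{R}^d\times\mathbb{R}^d} c(x,y)\, d\gamma(x,y).$$ Conversely, any $\gamma\in\Pi(\mu,\nu)$ that minimizes the expected cost $\int c\,d\gamma$ over $\Pi(\mu,\nu)$ is a maximizer of the expected cosine similarity $\int \phi\,d\gamma$ over $\Pi(\mu,\nu)$.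
   Context: Here $\pi_X,\pi_Y:\mathbb{R}^d\times\mathbb{R}^d\to\mathbb{R}^d$ are the projections onto the first and second factor, $(\pi)_\#\gamma$ denotes the pushforward of the measure $\gamma$ under the map $\pi$, and $\langle\cdot,\cdot\rangle$ and $\|\cdot\|$ are the Euclidean inner product and norm on $\mathbb{R}^d$. *)

(* Defs.v *)
From HB Require Import structures.
From mathcomp Require Import all_boot all_order all_algebra.
From mathcomp Require Import all_classical all_reals all_analysis.

Set Implicit Arguments.
Unset Strict Implicit.
Unset Printing Implicit Defensive.

Import Order.TTheory GRing.Theory Num.Theory.

Local Open Scope classical_set_scope.
Local Open Scope ring_scope.
Local Open Scope ereal_scope.

(* [d.-tuple R] carries the sigma-algebra generated by the coordinate maps,
   which is the Borel sigma-algebra of R^d; products of such spaces carry the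
   product sigma-algebra, i.e. the Borel sigma-algebra of R^d x R^d. *)
Notation euclid R d := (d.-tuple R).

Section Cosine.
Context {R : realType} {d : nat}.

Definition inner (x y : euclid R d) : R :=
  (\sum_(i < d) tnth x i * tnth y i)%R.

Definition enorm (x : euclid R d) : R := Num.sqrt (inner x x).

(* The quotient is undefined in the paper when x or y is the zero vector; since
   [0^-1 = 0] here, the cosine similarity with the zero vector is 0. *)
Definition cosine_sim (x y : euclid R d) : R :=
  (inner x y / (enorm x * enorm y))%R.

Definition cosine_cost (x y : euclid R d) : R := (- cosine_sim x y)%R.

End Cosine.

Section Transport.
Context {d1 d2 : measure_display} {X : measurableType d1}
  {Y : measurableType d2} {R : realType}.

(* Equality of measures is equality on measurable sets: the values of a
   [probability] on non-measurable sets are unconstrained. *)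
Definition couplings (mu : probability X R) (nu : probability Y R)
    : set (probability (X * Y)%type R) :=
  [set gamma | (forall A, measurable A -> pushforward gamma fst A = mu A) /\
               (forall B, measurable B -> pushforward gamma snd B = nu B)].

Definition expected (f : X -> Y -> R) (gamma : probability (X * Y)%type R)
    : \bar R :=
  \int[gamma]_z (f z.1 z.2)%:E.

End Transport.

Section Argopt.
Context {R : realType} {T : Type}.

Definition argmax (A : set T) (F : T -> \bar R) : set T :=
  [set x | A x /\ forall y, A y -> F y <= F x].

Definition argmin (A : set T) (F : T -> \bar R) : set T :=
  [set x | A x /\ forall y, A y -> F x <= F y].

End Argopt.

(* Main.v *)
(** The cosine similarity is Borel measurable and, by the Cauchy-Schwarz
    inequality, takes values in [-1, 1].  It is therefore integrable against
    every probability measure, so that the expected cost is the opposite of the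
    expected similarity, and negation exchanges maximizers and minimizers. *)

Require Import Defs.
From HB Require Import structures.
From mathcomp Require Import all_boot all_order all_algebra.
From mathcomp Require Import all_classical all_reals all_analysis.
From mathcomp Require Import measurable_realfun ring.

Import Order.TTheory GRing.Theory Num.Theory.

Section CosineSimilarity.
Context {R : realType} {d : nat}.
Local Open Scope ring_scope.
Implicit Types x y : euclid R d.

Lemma inner_ge0 x : 0 <= inner x x.
Proof. by apply: sumr_ge0 => i _; rewrite -expr2 sqr_ge0. Qed.

Lemma sqr_enorm x : enorm x ^+ 2 = inner x x.
Proof. exact/sqr_sqrtr/inner_ge0. Qed.

Lemma ler_norm_cosine_sim x y : `|cosine_sim x y| <= 1.
Proof.
rewrite /cosine_sim normrM normfV.
set a := enorm x; set b := enorm y.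
(* If a vector is zero, the convention [0^-1 = 0] makes the quotient 0. *)
have [->|ab_neq0] := eqVneq (a * b) 0; first by rewrite normr0 invr0 mulr0.
have ab_gt0 : 0 < a * b by rewrite lt_neqAle eq_sym ab_neq0 mulr_ge0 ?sqrtr_ge0.
rewrite (gtr0_norm ab_gt0) ler_pdivrMr // mul1r.
(* Expand [0 <= |b x - s a y|^2] for a sign [s]. *)
have bound (s : R) : s ^+ 2 = 1 -> s * inner x y <= a * b.
  (* After scaling by [2 * (a * b)], both sides become sums over coordinates and can be compared
     term by term. *)
  move=> s2; rewrite -(ler_pM2l ab_gt0) -(ler_pM2l (ltr0Sn R 1)).
  have -> : 2 * (a * b * (a * b)) = b ^+ 2 * inner x x + a ^+ 2 * inner y y.
    by rewrite -!sqr_enorm -/a -/b; ring.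
  rewrite /inner !mulr_sumr -big_split /=; apply: ler_sum => i _.
  rewrite -subr_ge0; set u := tnth x i; set v := tnth y i.
  (* Completing the square leaves a remainder with factor [1 - s ^+ 2], which vanishes for a
     sign. *)
  have -> : b ^+ 2 * (u * u) + a ^+ 2 * (v * v) - 2 * (a * b * (s * (u * v)))
      = (b * u - s * a * v) ^+ 2 + (1 - s ^+ 2) * (a * v) ^+ 2 by ring.
  by rewrite s2 subrr mul0r addr0 sqr_ge0.
(* The two halves of the absolute value bound are the cases [s = -1] and [s = 1]. *)
rewrite ler_norml lerNl -mulN1r -[X in _ && (X <= _)]mul1r.
by rewrite !bound ?sqrrN ?expr1n.
Qed.

End CosineSimilarity.

Section CosineIntegrable.
Context {R : realType} {d : nat}.
Local Open Scope ring_scope.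

Lemma measurable_inner {dT : measure_display} {T : measurableType dT}
    (f g : T -> euclid R d) :
  measurable_fun setT f -> measurable_fun setT g ->
  measurable_fun setT (fun t => inner (f t) (g t)).
Proof.
move=> mf mg; apply: measurable_sum => i.
by apply: measurable_funM; apply: (measurableT_comp (measurable_tnth i)).
Qed.

(* Square roots and inverses are rewritten as real powers, which are known to
   be measurable; the identity also holds at [0], where both sides are [0]. *)
Lemma cosine_simE (x y : euclid R d) :
  cosine_sim x y =
  inner x y * (inner x x `^ 2^-1 * inner y y `^ 2^-1) `^ (-1).
Proof.
by rewrite !powR12_sqrt ?inner_ge0 // powR_inv1 // mulr_ge0 ?sqrtr_ge0.
Qed.

Lemma measurable_cosine_sim :
  measurable_fun setT (fun z : euclid R d * euclid R d => cosine_sim z.1 z.2).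
Proof.
under eq_fun do rewrite cosine_simE.
apply: measurable_funM; first exact: measurable_inner.
apply: (measurableT_comp (measurable_powR _)).
by apply: measurable_funM; apply: (measurableT_comp (measurable_powR _));
  exact: measurable_inner.
Qed.

Lemma integrable_cosine_sim
    (gamma : probability (euclid R d * euclid R d)%type R) :
  gamma.-integrable setT (fun z => (cosine_sim z.1 z.2)%:E).
Proof.
apply: measurable_bounded_integrable => //.
- exact: le_lt_trans (probability_le1 gamma measurableT) (ltry 1).
- exact: measurable_cosine_sim.
- exists 1; split; first exact: num_real.
  by move=> M /ltW M1 z _; apply: le_trans M1; exact: ler_norm_cosine_sim.
Qed.

Lemma expected_cosine_cost
    (gamma : probability (euclid R d * euclid R d)%type R) :
  expected cosine_cost gamma = (- expected cosine_sim gamma)%E.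
Proof.
(* Negation passes through the integral once the integrals of the positive and negative parts are
   not both infinite; integrability ensures this. *)
rewrite /expected -integralN //.
exact/integrable_add_def/integrable_cosine_sim.
Qed.

End CosineIntegrable.

Lemma argmin_oppe {R : realType} {T : Type} (A : set T) (F : T -> \bar R) :
  argmin A (fun t => - F t)%E = argmax A F.
Proof.
by apply/seteqP; split => t [At opt]; split => // s As;
  have := opt s As; rewrite leeN2.
Qed.

Theorem proposition5p1 (R : realType) (d : nat)
    (mu nu : probability (euclid R d) R) :
  (forall gamma : probability (euclid R d * euclid R d)%type R,
     argmax (couplings mu nu) (expected cosine_sim) gamma ->
     argmin (couplings mu nu) (expected cosine_cost) gamma) /\
  (forall gamma : probability (euclid R d * euclid R d)%type R,
     argmin (couplings mu nu) (expected cosine_cost) gamma ->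
     argmax (couplings mu nu) (expected cosine_sim) gamma).
Proof.
(* Both implications follow at once from equality of the two sets of optimizers. *)
have -> : argmin (couplings mu nu) (expected cosine_cost) =
          argmax (couplings mu nu) (expected cosine_sim).
  rewrite -argmin_oppe; congr argmin.
  exact/funext/expected_cosine_cost.
by [].
Qed.
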